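(* For each $n\ge1$ let $\mathcal{C}_1(\mathbb{T}^n)$ be the collection of continuous functions $\mathbb{T}^n\to\mathbb{C}$. Then $\mathcal{C}_1=\bigcup_{n\ge1}\mathcal{C}_1(\mathbb{T}^n)$ is a Boyd--Lawton collection.
   Context: $\mathbb{T}$ is the unit circle in $\mathbb{C}$; $\mathbb{T}^n=\{(z_1,\dots,z_n)\in\mathbb{C}^n: |z_1|=\dots=|z_n|=1\}$ is a compact group under coordinatewise multiplication, with normalized Haar measure $\tau_n$ (total mass 1); $\tau=\tau_1$. For an $n\times m$ integer matrix $A=(a_{ij})$, $q_A\colon\mathbb{T}^m\to\mathbb{T}^n$ is the continuous homomorphism $q_A(z_1,\dots,z_m)=(z_1^{a_{11}}z_2^{a_{12}}\cdots z_m^{a_{1m}},\dots,z_1^{a_{n1}}z_2^{a_{n2}}\cdots z_m^{a_{nm}})$. A vector $\mathbf{r}\in\mathbb{Z}^n$ is viewed as an $n\times1$ matrix, so $q_{\mathbf{r}}\colon\mathbb{T}\to\mathbb{T}^n$, $q_{\mathbf r}(z)=(z^{r_1},\dots,z^{r_n})$. The Boyd height is $\mu(q_A)=\mu(A)=\min\{\|\mathbf{v}\|_\infty:\mathbf{v}\in\mathbb{Z}^n,\ \mathbf{v}\ne\mathbf{0},\ \mathbf{v}\cdot A=\mathbf{0}\}$ ($\mathbf v$ a row vector), and $\mu(q_A)=\infty$ if no such $\mathbf{v}$ exists. A Boyd--Lawton collection $\mathcal{C}=\bigcup_{n\ge1}\mathcal{C}(\mathbb{T}^n)$ is a collection of functions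 such that: (1) If $g\in\mathcal{C}(\mathbb{T}^n)$ then $g$ is defined and complex-valued almost everywhere on $\mathbb{T}^n$ and is integrable (it gives an element of $L^1(\mathbb{T}^n)$). (2) For each $g\in\mathcal{C}(\mathbb{T}^n)$ with $n\ge2$, $\int_{\mathbb{T}^n}g\,d\tau_n=\lim_{\mu(q_{\mathbf r})\to\infty}\int_{\mathbb{T}}g\circ q_{\mathbf r}\,d\tau$, where $q_{\mathbf r}\colon\mathbb{T}\to\mathbb{T}^n$ varies over the homomorphisms given by $\mathbf r\in\mathbb{Z}^n$ (implicit: for all large enough $\mu(q_{\mathbf r})$ the function $g\circ q_{\mathbf r}$ is integrable). The limit means: for every $\varepsilon>0$ there is $M$ such that the two integrals differ by less than $\varepsilon$ whenever $\mu(q_{\mathbf r})\ge M$. (3) If $g\in\mathcal{C}(\mathbb{T}^n)$, there is a bound $B$ such that for every $m\ge1$ and every $q_A\colon\mathbb{T}^m\to\mathbb{T}^n$ with $\mu(q_A)\ge B$, the composition $g\circ q_A$ is in $\mathcal{C}(\mathbb{T}^m)$. *)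

(* Defs.v *)
From HB Require Import structures.
From mathcomp Require Import all_boot all_order all_algebra.
From mathcomp Require Import complex.
From mathcomp Require Import all_classical all_reals all_analysis.
Set Implicit Arguments.
Unset Strict Implicit.
Unset Printing Implicit Defensive.
Import Order.TTheory GRing.Theory Num.Theory.
Import numFieldNormedType.Exports.
Local Open Scope classical_set_scope.
Local Open Scope ring_scope.
Local Open Scope complex_scope.

(* [R[i]] packed as a [numClosedFieldType]: MathComp-Analysis attaches the norm
   topology to the sort of such a structure, not to [complex R] itself. *)
Definition Cplx (R : realType) : numClosedFieldType := R[i].

Section torus.
Context {R : realType}.
Local Notation C := (Cplx R).

Definition torus_set (n : nat) : set 'rV[C]_n :=
  [set z | forall i, `|z ord0 i| = 1].
Arguments torus_set : clear implicits.
Definition torus (n : nat) : Type := set_type (torus_set n).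

HB.instance Definition _ n := Topological.on (torus n).

Definition tcoord n (z : torus n) (i : 'I_n) : C := set_val z ord0 i.

Lemma normr_tcoord n (z : torus n) i : `|tcoord z i| = 1.
Proof. by have /set_mem /= := svalP z; exact. Qed.

Fact mk_torus_subproof n (f : 'I_n -> C) :
  (forall i, `|f i| = 1) -> \row_i f i \in torus_set n.
Proof. by move=> f1; apply/mem_set => i; rewrite mxE. Qed.

Definition mk_torus n (f : 'I_n -> C) (f1 : forall i, `|f i| = 1) : torus n :=
  SigSub (mk_torus_subproof f1).

Fact torus_one_subproof n (i : 'I_n) : `|1 : C| = 1.
Proof. exact: normr1. Qed.

Definition torus_one n : torus n := mk_torus (@torus_one_subproof n).

HB.instance Definition _ n := isPointed.Build (torus n) (torus_one n).

Fact torus_mul_subproof n (a z : torus n) (i : 'I_n) :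
  `|tcoord a i * tcoord z i| = 1.
Proof. by rewrite normrM !normr_tcoord mulr1. Qed.

Definition torus_mul n (a z : torus n) : torus n :=
  mk_torus (torus_mul_subproof a z).

Fact qmap_subproof n m (A : 'M[int]_(n, m)) (z : torus m) (i : 'I_n) :
  `|\prod_j tcoord z j ^ A i j| = 1.
Proof.
rewrite normr_prod big1 // => j _; case: (A i j) => k.
  by rewrite -exprnP normrX normr_tcoord expr1n.
by rewrite NegzE -exprnN normfV normrX normr_tcoord expr1n invr1.
Qed.

Definition qmap n m (A : 'M[int]_(n, m)) (z : torus m) : torus n :=
  mk_torus (qmap_subproof A z).

Definition borel_torus (n : nat) := g_sigma_algebraType (@open (torus n)).

End torus.
Arguments torus_set : clear implicits.
Arguments torus : clear implicits.
Arguments borel_torus : clear implicits.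

(* [tau] has total mass 1 by its type; Haar measure is the unique
   translation-invariant one. *)
Definition is_haar (R : realType) n (tau : probability (borel_torus R n) R) :=
  forall (a : torus R n) (A : set (borel_torus R n)),
    measurable A -> tau (torus_mul a @` A) = tau A.

Section boyd_height.
Context n m (A : 'M[int]_(n, m)).

Definition sup_norm (v : 'rV[int]_n) : nat := \max_(i < n) `|v ord0 i|%N.

Definition relation_norms : set nat :=
  [set sup_norm v | v in [set v : 'rV[int]_n | v != 0 /\ v *m A = 0]].

Definition boyd_height (R : realType) : \bar R :=
  match pselect (exists k, `[< relation_norms k >]) with
  | left ex => ((ex_minn ex)%:R)%:E
  | right _ => +oo%E
  end.

End boyd_height.

Section integration.
Context {R : realType} n (tau : probability (borel_torus R n) R).
Local Notation C := (Cplx R).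

Definition cintegrable (f : torus R n -> C) : Prop :=
  tau.-integrable setT (fun z : borel_torus R n => (complex.Re (f z))%:E) /\
  tau.-integrable setT (fun z : borel_torus R n => (complex.Im (f z))%:E).

Definition cintegral (f : torus R n -> C) : C :=
  (\int[tau]_z complex.Re (f z)) +i* (\int[tau]_z complex.Im (f z)).

(* [None] stands for "undefined or not complex-valued".  The Borel measure
   [tau] is not completed, so [g] is only required to agree almost everywhere
   with a Borel integrable function, as for elements of L^1. *)
Definition represents (f : torus R n -> C) (g : torus R n -> option C) : Prop :=
  cintegrable f /\ {ae tau, forall z, g z = Some (f z)}.

Definition in_L1 (g : torus R n -> option C) : Prop :=
  exists f, represents f g.

Definition has_integral (g : torus R n -> option C) (I : C) : Prop :=
  exists2 f, represents f g & cintegral f = I.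

End integration.

Record Boyd_Lawton (R : realType)
    (tau : forall n, probability (borel_torus R n) R)
    (F : forall n, set (torus R n -> option (Cplx R))) : Prop := {
  BL_L1 : forall n, (1 <= n)%N -> forall g, F n g -> in_L1 (tau n) g;
  BL_limit : forall n, (2 <= n)%N -> forall g, F n g ->
    exists2 I, has_integral (tau n) g I &
      forall eps : R, 0 < eps -> exists M : nat, forall r : 'cV[int]_n,
        (M%:R%:E <= boyd_height r R)%E ->
        exists2 J, has_integral (tau 1%N) (g \o qmap r) J & `|J - I| < eps%:C;
  BL_comp : forall n, (1 <= n)%N -> forall g, F n g ->
    exists B : nat, forall m, (1 <= m)%N -> forall A : 'M[int]_(n, m),
      (B%:R%:E <= boyd_height A R)%E -> F m (g \o qmap A) }.

Definition continuous_collection (R : realType) (n : nat) :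
    set (torus R n -> option (Cplx R)) :=
  [set Some \o f | f in [set f : torus R n -> Cplx R | continuous f]].

(* Main.v *)
Require Import Defs.
From mathcomp Require Import all_boot all_order all_algebra.
From mathcomp Require Import all_classical all_reals all_analysis.
From mathcomp Require Import measurable_realfun complex ring lra.
Set Implicit Arguments.
Unset Strict Implicit.
Unset Printing Implicit Defensive.
Import Order.TTheory GRing.Theory Num.Theory.
Import numFieldNormedType.Exports.
Local Open Scope classical_set_scope.
Local Open Scope ring_scope.
Local Open Scope complex_scope.

(** The collection is closed under composition with the [qmap A] because these
    are continuous, and continuous functions are integrable because the torus
    is compact.  The content is the limit formula, a form of Weyl
    equidistribution.

    For the character [chi v] of [T^n] attached to an integer vector [v], one
    has [chi v (qmap r z) = chi (v *m r) z].  A nontrivial character has mean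
    zero: some translation changes its sign, and Haar measure does not see
    translations ([mean_chi]).  As soon as the Boyd height of [r] exceeds the
    sup norm of a nonzero [v], the vector [v *m r] is nonzero, so [chi v] and
    [chi v \o qmap r] both have mean zero.  Hence every trigonometric polynomial
    is integrated without error by [qmap r] once the height of [r] is large
    ([eventually_exact]), and it is enough to approximate a continuous function
    uniformly by trigonometric polynomials.

    The approximation is by an approximate identity.  Let
    [K w x] be the product over [j] of [(1 + cos (x_j - w_j)) / 2] in angular
    notation ([raised_cosine]).  It lies in [0, 1], equals 1 only on the
    diagonal, is invariant under simultaneous translation, and its powers are
    trigonometric polynomials in [w] and [x].  Smoothing [f] by [K ^+ N],
    divided by its mass, gives a trigonometric polynomial
    ([eventually_exact_smoothing]), and it differs from [f] by at most
    [eps / 2 + 2 * M * q ^+ N / mass], where [M] bounds [f] and [q < 1] bounds [K]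
    at pairs where [f] varies by [eps / 2] or more ([peak_gap],
    [smoothing_error]).  Compactness and translation invariance bound the mass
    below by a constant multiple of [q' ^+ N], for any [q' < 1]
    ([raised_cosine_mass_ge]); taking [q < q'], the error term tends to 0 as
    [N] grows. *)

(** * Continuity of pointwise operations and of kernels *)

Lemma continuous_fst (S T U : topologicalType) (f : S -> U) :
  continuous f -> continuous (fun p : S * T => f p.1).
Proof.
move=> cf p; apply: (@continuous_comp _ _ _ (@fst S T) f); last exact: cf.
exact: cvg_fst.
Qed.

Lemma continuous_snd (S T U : topologicalType) (f : T -> U) :
  continuous f -> continuous (fun p : S * T => f p.2).
Proof.
move=> cf p; apply: (@continuous_comp _ _ _ (@snd S T) f); last exact: cf.
exact: cvg_snd.
Qed.

Lemma continuous_funM (K : numFieldType) (T : topologicalType) (f g : T -> K) :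
  continuous f -> continuous g -> continuous (fun x => f x * g x).
Proof. by move=> cf cg x; apply: (@cvgM K _ _ _ f g); [exact: cf|exact: cg]. Qed.

Lemma continuous_funD (K : numFieldType) (T : topologicalType) (f g : T -> K) :
  continuous f -> continuous g -> continuous (fun x => f x + g x).
Proof. by move=> cf cg x; apply: (@cvgD K K _ _ _ f g); [exact: cf|exact: cg]. Qed.

Lemma continuous_funB (K : numFieldType) (T : topologicalType) (f g : T -> K) :
  continuous f -> continuous g -> continuous (fun x => f x - g x).
Proof. by move=> cf cg x; apply: (@cvgB K K _ _ _ f g); [exact: cf|exact: cg]. Qed.

Lemma continuous_normf (R : realType) (T : topologicalType) (f : T -> R) :
  continuous f -> continuous (fun x => `|f x|).
Proof.
move=> cf x; apply: (@continuous_comp _ _ _ f (fun t : R => `|t|)); first exact: cf.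
exact: norm_continuous.
Qed.

Lemma continuous_prod (K : numFieldType) (T : topologicalType) (I : Type)
    (r : seq I) (f : I -> T -> K) :
  (forall i, continuous (f i)) -> continuous (fun x => \prod_(i <- r) f i x).
Proof.
move=> cf; elim: r => [|i r IH].
  by under eq_fun do rewrite big_nil; exact: cst_continuous.
by under eq_fun do rewrite big_cons; exact: continuous_funM.
Qed.

Lemma continuous_sum (K : numFieldType) (T : topologicalType) (I : Type)
    (r : seq I) (f : I -> T -> K) :
  (forall i, continuous (f i)) -> continuous (fun x => \sum_(i <- r) f i x).
Proof.
move=> cf; elim: r => [|i r IH].
  by under eq_fun do rewrite big_nil; exact: cst_continuous.
by under eq_fun do rewrite big_cons; exact: continuous_funD.
Qed.

Section joint_continuity.
Context {R : realType} {X : topologicalType}.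
Implicit Types (k l : X -> X -> R) (f : X -> R).

Definition jointly_continuous k := continuous (fun p : X * X => k p.1 p.2).

Lemma jointly_continuousD k l : jointly_continuous k -> jointly_continuous l ->
  jointly_continuous (fun w x => k w x + l w x).
Proof. exact: continuous_funD. Qed.

Lemma jointly_continuousM k l : jointly_continuous k -> jointly_continuous l ->
  jointly_continuous (fun w x => k w x * l w x).
Proof. exact: continuous_funM. Qed.

Lemma jointly_continuous_cst (c : R) : jointly_continuous (fun _ _ => c).
Proof. exact: cst_continuous. Qed.

Lemma jointly_continuousl f : continuous f -> jointly_continuous (fun w _ => f w).
Proof. exact: continuous_fst. Qed.

Lemma jointly_continuousr f : continuous f -> jointly_continuous (fun _ x => f x).
Proof. exact: continuous_snd. Qed.

Lemma separately_continuous k : jointly_continuous k ->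
  (forall x, continuous (fun w => k w x)) /\ (forall w, continuous (k w)).
Proof.
move=> ck; split=> [x w|w x].
  apply: (@continuous2_cvg X X X R (nbhs w) (nbhs_filter w) id (fun=> x) k w x) => //.
  - exact (ck (w, x)).
  - exact: cvg_cst.
apply: (@continuous2_cvg X X X R (nbhs x) (nbhs_filter x) (fun=> w) id k w x) => //.
- exact (ck (w, x)).
- exact: cvg_cst.
Qed.

(** A uniform continuity statement in which closeness of [w] and [x] is measured
    by how near [k w x] is to its maximum 1.  The pairs where [f] varies by at
    least [eps] form a compact set that misses the diagonal, so the maximum [q]
    of [k] on it is less than 1. *)
Lemma peak_gap k f (eps : R) : compact [set: X] -> jointly_continuous k ->
  (forall w x, k w x <= 1) -> (forall w x, 0 <= k w x) ->
  (forall w x, k w x = 1 -> w = x) -> continuous f -> 0 < eps ->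
  exists2 q : R, 0 <= q < 1 & forall w x, eps <= `|f w - f x| -> k w x <= q.
Proof.
move=> cX ck k1 k0 k_eq1 cf e0; pose Z := [set p : X * X | eps <= `|f p.1 - f p.2|].
have [Z0|/set0P Zn0] := eqVneq Z set0.
  exists 0; first by rewrite lexx ltr01.
  by move=> w x h; have : Z (w, x) by []; rewrite Z0.
have cd : continuous (fun p : X * X => `|f p.1 - f p.2|).
  exact (continuous_normf (continuous_funB (continuous_fst cf) (continuous_snd cf))).
have cZ : compact Z.
  apply: (subclosed_compact (B := setT)) => //.
    by move/continuous_closedP : cd => /(_ _ (@closed_ge R eps)).
  by rewrite -setXTT; exact: compact_setX.
have ckZ : {within Z, continuous (fun p : X * X => k p.1 p.2)}.
  by apply: continuous_subspaceT; exact: ck.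
have [c cZ' cmax] := compact_EVT_max Zn0 cZ ckZ.
exists (k c.1 c.2).
  rewrite k0 lt_neqAle k1 andbT; apply/eqP => /k_eq1 c12.
  by move: cZ'; rewrite inE /Z /= c12 subrr normr0 leNgt e0.
by move=> w x h; apply: (cmax (w, x)); rewrite inE.
Qed.

End joint_continuity.

(** * Topology of the complex numbers and of the torus *)

Section complex_topology.
Context {R : realType}.
Local Notation C := (Cplx R).

Lemma ReB (z w : C) : complex.Re (z - w) = complex.Re z - complex.Re w.
Proof. by case: z => ? ?; case: w. Qed.

Lemma continuous_Re : continuous (fun z : C => complex.Re z).
Proof.
move=> z; apply/(@cvgrPdist_lt _ _ _ _ (nbhs_filter (z : C))) => e e0.
have e0C : 0 < (e%:C : C) by rewrite ltcR.
have zFF := nbhs_filter (z : C).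
have := @cvgr_dist_lt _ C _ _ zFF id z cvg_id _ e0C.
apply: filterS => w /(le_lt_trans (normc_ge_Re (z - w))).
by rewrite ltcR ReB.
Qed.

Lemma continuous_Im : continuous (fun z : C => complex.Im z).
Proof.
have cM : continuous (fun z : C => z * ('i%C : C)).
  exact: mulrr_continuous.
have -> : (fun z : C => complex.Im z) =
    - ((fun z : C => complex.Re z) \o (fun z : C => z * ('i%C : C))).
  by apply/funext => z; rewrite -[LHS]opprK -ReiNIm.
move=> z; apply: continuousN; apply: continuous_comp; first exact: cM.
exact: continuous_Re.
Qed.

Lemma continuous_real_complex : continuous (fun x : R => x%:C : C).
Proof.
move=> x; apply/cvgrPdist_lt => e; rewrite ltcE /= => /andP[/eqP ime ree].
near=> y.
rewrite -rmorphB normc_def/= expr0n/= addr0 sqrtr_sqr ltcE/= ime eqxx/=.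
by near: y; apply: cvgr_dist_lt => //; exact: cvg_id.
Unshelve. all: by end_near. Qed.

End complex_topology.

Section torus_topology.
Context {R : realType}.
Local Notation C := (Cplx R).
Local Notation torus := (torus R).

Lemma torus_ext n (w z : torus n) : tcoord w =1 tcoord z -> w = z.
Proof. by move=> wz; apply/val_inj/rowP => i; exact: wz. Qed.

Lemma tcoord_mk n (f : 'I_n -> C) f1 i : tcoord (@mk_torus R n f f1) i = f i.
Proof. by rewrite /tcoord set_valE /= mxE. Qed.

Lemma continuous_tcoord n (i : 'I_n) : continuous (fun z : torus n => tcoord z i).
Proof.
move=> z; apply: (@continuous_comp _ _ _ (set_val : torus n -> 'rV[C]_n)
  (fun M : 'rV[C]_n => M ord0 i)).
  exact: initial_continuous.
exact: coord_continuous.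
Qed.

Lemma continuous_to_torus (X : topologicalType) n (f : X -> torus n) :
  (forall i, continuous (fun x => tcoord (f x) i)) -> continuous f.
Proof.
move=> cf; apply: continuous_comp_initial => x U [P PU sPU].
have H : \forall y \near x, forall j, P ord0 j (tcoord (f y) j).
  by apply: filter_forall => j; apply: cf; exact: PU.
apply: filterS H => y Py.
by apply: sPU => i j; rewrite (ord1 i).
Qed.

Lemma unit_cos_sin (z : C) : `|z| = 1 ->
  exists t : R, - pi <= t <= pi /\ z = cos t +i* sin t.
Proof.
case: z => x y; rewrite normc_def /= => -[xy1].
have {}xy1 : x ^+ 2 + y ^+ 2 = 1.
  by rewrite -[LHS]sqr_sqrtr ?addr_ge0 ?sqr_ge0// xy1 expr1n.
have x1 : -1 <= x <= 1.
  by rewrite -ler_norml -(ler_pXn2r (n := 2))// ?nnegrE// real_normK ?num_real//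
    expr1n -xy1 lerDl sqr_ge0.
have cx : cos (acos x) = x by apply: acosK; rewrite in_itv.
have sx : sin (acos x) = `|y|.
  by rewrite sin_acos// -sqrtr_sqr; congr Num.sqrt; rewrite -xy1 addrC addKr.
have a0 := acos_ge0 x1; have api := acos_lepi x1; have pi0 := pi_ge0 R.
have [y0|y0] := leP 0 y.
  by exists (acos x); rewrite cx sx ger0_norm//; split=> //; lra.
by exists (- acos x); rewrite cosN sinN cx sx ltr0_norm// opprK; split=> //; lra.
Qed.

Lemma continuous_cos_sin : continuous (fun t : R => (cos t +i* sin t : C)).
Proof.
have -> : (fun t : R => (cos t +i* sin t : C)) =
    ((fun x : R => x%:C : C) \o cos) + (fun t => ('i%C : C) * ((sin t)%:C : C)).
  by apply/funext => t; rewrite [LHS]complexE.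
move=> t; apply: continuousD.
  by apply: continuous_comp; [exact: continuous_cos|exact: continuous_real_complex].
apply: continuousM; first exact: cst_continuous.
apply: (@continuous_comp _ _ _ sin (fun x : R => x%:C : C)); first exact: continuous_sin.
exact: continuous_real_complex.
Qed.

Lemma norm_cos_sin (t : R) : `|cos t +i* sin t : C| = 1.
Proof. by rewrite normc_def /= cos2Dsin2 sqrtr1. Qed.

(** The torus is a continuous image of a box of angles. *)
Lemma torus_compact n : compact [set: torus n].
Proof.
pose e (th : 'rV[R]_n) : torus n := mk_torus (fun i => norm_cos_sin (th ord0 i)).
have ce : continuous e.
  apply: continuous_to_torus => i.
  under eq_fun do rewrite tcoord_mk.
  move=> th; apply: (@continuous_comp _ _ _ (fun th : 'rV[R]_n => th ord0 i)
    (fun t : R => (cos t +i* sin t : C))).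
    exact: coord_continuous.
  exact: continuous_cos_sin.
have -> : [set: torus n] =
    e @` [set th : 'rV[R]_n | forall i, `[- pi, pi]%classic (th ord0 i)].
  apply/seteqP; split => // z _.
  have /choice [t tP] : forall i, exists t : R,
      - pi <= t <= pi /\ tcoord z i = cos t +i* sin t.
    move=> i; exact: unit_cos_sin (normr_tcoord z i).
  exists (\row_i t i) => [i /=|]; first by rewrite mxE in_itv/=; case: (tP i).
  by apply: torus_ext => i; rewrite tcoord_mk mxE; case: (tP i).
apply: continuous_compact; first exact: continuous_subspaceT.
by apply: (@rV_compact R n (fun=> `[- pi, pi]%classic)) => i; exact: segment_compact.
Qed.

End torus_topology.

(** * Characters of the torus *)

Section characters.
Context {R : realType}.
Local Notation C := (Cplx R).
Local Notation torus := (torus R).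

Lemma tcoord_neq0 n (z : torus n) i : tcoord z i != 0.
Proof. by rewrite -normr_eq0 normr_tcoord oner_neq0. Qed.

Lemma continuous_tcoordX n (i : 'I_n) (k : int) :
  continuous (fun z : torus n => tcoord z i ^ k).
Proof.
have cX m : continuous (fun z : torus n => tcoord z i ^+ m).
  elim: m => [|m IH].
    by under eq_fun do rewrite expr0; exact: cst_continuous.
  under eq_fun do rewrite exprS.
  exact: (continuous_funM (@continuous_tcoord R n i) IH).
case: k => m; first exact: cX.
move=> z; have zm0 : tcoord z i ^+ m.+1 != 0 by rewrite expf_neq0// tcoord_neq0.
exact: (@cvgV C _ _ _ (fun z : torus n => tcoord z i ^+ m.+1) _ zm0 (cX _ z)).
Qed.

Lemma continuous_qmap n m (A : 'M[int]_(n, m)) :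
  continuous (qmap A : torus m -> torus n).
Proof.
apply: continuous_to_torus => i.
under eq_fun do rewrite tcoord_mk.
exact: (@continuous_prod C _ _ _ (fun j z => tcoord z j ^ A i j)
  (fun j => @continuous_tcoordX m j (A i j))).
Qed.

Lemma continuous_torus_mul n (a : torus n) : continuous (torus_mul a).
Proof.
apply: continuous_to_torus => i.
under eq_fun do rewrite tcoord_mk.
exact: (continuous_funM (@cst_continuous _ C _) (@continuous_tcoord R n i)).
Qed.

(** The character with exponent vector [v], as the single coordinate of the
    homomorphism to the circle with matrix [v]. *)
Definition chi n (v : 'rV[int]_n) (z : torus n) : C := tcoord (qmap v z) ord0.

Lemma chiE n (v : 'rV[int]_n) z : chi v z = \prod_j tcoord z j ^ v ord0 j.
Proof. exact: tcoord_mk. Qed.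

Lemma norm_chi n (v : 'rV[int]_n) z : `|chi v z| = 1.
Proof. exact: normr_tcoord. Qed.

Lemma continuous_chi n (v : 'rV[int]_n) : continuous (chi v).
Proof.
move=> z; apply: (@continuous_comp _ _ _ (qmap v) (fun z : torus 1 => tcoord z ord0)).
  exact: continuous_qmap.
exact: (@continuous_tcoord R 1 ord0).
Qed.

Lemma chi0 n (z : torus n) : chi 0 z = 1.
Proof. by rewrite chiE big1// => j _; rewrite mxE expr0z. Qed.

Lemma chiD n (u v : 'rV[int]_n) z : chi (u + v) z = chi u z * chi v z.
Proof.
rewrite !chiE -big_split /=; apply: eq_bigr => j _.
by rewrite mxE expfzDr// tcoord_neq0.
Qed.

Lemma chiN n (v : 'rV[int]_n) z : chi (- v) z = (chi v z)^*.
Proof.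
have /mulfI : chi v z != 0 by exact: tcoord_neq0.
apply; rewrite -chiD subrr chi0.
by rewrite -sqr_normc norm_chi expr1n.
Qed.

Lemma chi_delta n (j : 'I_n) z : chi (delta_mx ord0 j) z = tcoord z j.
Proof.
rewrite chiE (bigD1 j)//= mxE !eqxx expr1z big1 ?mulr1// => i ij.
by rewrite mxE (negbTE ij) expr0z.
Qed.

Lemma chi_mul n (v : 'rV[int]_n) a z : chi v (torus_mul a z) = chi v a * chi v z.
Proof.
rewrite !chiE -big_split /=; apply: eq_bigr => j _.
by rewrite tcoord_mk expfzMl.
Qed.

Lemma chi_qmap n m (v : 'rV[int]_n) (A : 'M[int]_(n, m)) z :
  chi v (qmap A z) = chi (v *m A) z.
Proof.
rewrite !chiE.
under eq_bigr do rewrite tcoord_mk.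
under [RHS]eq_bigr => j _.
  rewrite mxE.
  have -> : tcoord z j ^ (\sum_k v ord0 k * A k j) =
      \prod_k tcoord z j ^ (v ord0 k * A k j).
    apply: (big_morph (fun k : int => tcoord z j ^ k)) => [k l|]; last by rewrite expr0z.
    by rewrite expfzDr// tcoord_neq0.
  over.
rewrite exchange_big /=; apply: eq_bigr => i _.
rewrite -[RHS]/(\prod_(j < m) _).
have -> : (\prod_j tcoord z j ^ A i j) ^ v ord0 i =
    \prod_j (tcoord z j ^ A i j) ^ v ord0 i.
  apply: (big_morph (fun x : C => x ^ v ord0 i)) => [x y|]; last by rewrite exp1rz.
  by rewrite expfzMl.
by apply: eq_bigr => j _; rewrite exprz_exp mulrC.
Qed.

(** Put a root of order [`|v j|] of -1 at a coordinate [j] where [v] does not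
    vanish, and 1 elsewhere. *)
Lemma chi_eqN1 n (v : 'rV[int]_n) : v != 0 -> exists a, chi v a = -1.
Proof.
move=> /eqP/rowP/eqfunP /=; rewrite negb_forall => /existsP[j].
rewrite mxE; set k := v ord0 j => k0.
have k0' : (0 < `|k|)%N by rewrite absz_gt0.
pose w : C := (`|k|%N).-root (-1).
have wk : w ^+ `|k|%N = -1 by rewrite rootCK.
have w1 : `|w| = 1 by rewrite norm_rootC normrN1 rootC1.
have wk' : w ^ k = -1.
  case: (intP k) wk => [|m|m] /=; rewrite ?abszN //.
  by move=> wk; rewrite -exprnN wk invrN invr1.
have a1 i : `|if i == j then w else 1 : C| = 1 by case: ifP => // _; exact: normr1.
exists (mk_torus a1); rewrite chiE (bigD1 j)//= tcoord_mk eqxx wk' big1 ?mulr1// => i ij.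
by rewrite tcoord_mk (negbTE ij) exp1rz.
Qed.

End characters.

(** * Trigonometric kernels *)

Section kernels.
Context {R : realType} {n : nat}.
Local Notation C := (Cplx R).
Local Notation T := (torus R n).
Implicit Types (u v : 'rV[int]_n) (w x z : T).

(** The real part of the value of [chi v] at the quotient of [x] by [w]. *)
Definition pairing v w x : R := complex.Re ((chi v w)^* * chi v x).

Lemma pairing_split v w x : pairing v w x =
  complex.Re (chi v w) * complex.Re (chi v x) +
  complex.Im (chi v w) * complex.Im (chi v x).
Proof. by rewrite /pairing; case: (chi v w) => a b; case: (chi v x) => c d /=; ring. Qed.

Lemma pairingC v w x : pairing v w x = pairing v x w.
Proof.
by rewrite !pairing_split (mulrC (complex.Re (chi v w)))
  (mulrC (complex.Im (chi v w))).
Qed.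

Lemma pairing0 w x : pairing 0 w x = 1.
Proof. by rewrite /pairing !chi0 mulr1. Qed.

(** The product formula [2 cos a cos b = cos (a + b) + cos (a - b)]. *)
Lemma pairingM u v w x :
  pairing u w x * pairing v w x = 2^-1 * (pairing (u + v) w x + pairing (u - v) w x).
Proof.
rewrite /pairing !chiD !chiN.
case: (chi u w) => a b; case: (chi u x) => c d.
case: (chi v w) => a' b'; case: (chi v x) => c' d' /=; by field.
Qed.

Lemma pairing_mul v a w x : pairing v (torus_mul a w) (torus_mul a x) = pairing v w x.
Proof.
have a1 := norm_chi v a; move: a1; rewrite /pairing !chi_mul.
case: (chi v a) => p q; case: (chi v w) => c d; case: (chi v x) => c' d'.
rewrite normc_def => -[/(congr1 (fun t => t ^+ 2))].
rewrite sqr_sqrtr ?addr_ge0 ?sqr_ge0// expr1n /= => pq.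
by rewrite -[RHS]mul1r -pq; ring.
Qed.

Lemma pairing_diag v x : pairing v x x = 1.
Proof. by rewrite /pairing mulrC -sqr_normc norm_chi expr1n. Qed.

Lemma norm_pairing v w x : `|pairing v w x| <= 1.
Proof.
rewrite -lecR; apply: (le_trans (normc_ge_Re _)).
by rewrite normrM normcJ !norm_chi mulr1.
Qed.

(** The squared distance of two unit complex numbers is 2 minus twice their
    real pairing. *)
Lemma pairing_eq1 v w x : pairing v w x = 1 -> chi v w = chi v x.
Proof.
have := norm_chi v w; have := norm_chi v x.
rewrite pairing_split; case: (chi v w) => a b; case: (chi v x) => c d.
rewrite !normc_def /= => -[/(congr1 (fun t => t ^+ 2)) cd].
move=> [/(congr1 (fun t => t ^+ 2)) ab] h.
move: cd ab; rewrite !sqr_sqrtr ?addr_ge0 ?sqr_ge0// expr1n => cd ab.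
have h2 : (a - c) ^+ 2 + (b - d) ^+ 2 = 0.
  by rewrite !sqrrB; lra.
move/eqP: h2; rewrite paddr_eq0 ?sqr_ge0// !sqrf_eq0 !subr_eq0.
by move=> /andP[/eqP -> /eqP ->].
Qed.

Lemma continuous_Re_chi v : continuous (fun z => complex.Re (chi v z)).
Proof.
move=> z; apply: (@continuous_comp _ _ _ (chi v) (fun z : C => complex.Re z)).
  exact: continuous_chi.
exact: continuous_Re.
Qed.

Lemma continuous_Im_chi v : continuous (fun z => complex.Im (chi v z)).
Proof.
move=> z; apply: (@continuous_comp _ _ _ (chi v) (fun z : C => complex.Im z)).
  exact: continuous_chi.
exact: continuous_Im.
Qed.

(** Trigonometric polynomials in the quotient of [x] by [w].  The inductive form
    makes the stability under products, and the smoothing of functions by such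
    kernels, direct inductions. *)
Inductive trig_kernel : (T -> T -> R) -> Prop :=
| trig_pairing v : trig_kernel (pairing v)
| trig_add k l : trig_kernel k -> trig_kernel l ->
    trig_kernel (fun w x => k w x + l w x)
| trig_scale c k : trig_kernel k -> trig_kernel (fun w x => c * k w x).

Lemma trig_mul k l : trig_kernel k -> trig_kernel l ->
  trig_kernel (fun w x => k w x * l w x).
Proof.
move=> + tl; elim=> [u|k1 k2 _ IH1 _ IH2|c k1 _ IH1].
- elim: tl => [v|l1 l2 _ IH1 _ IH2|c l1 _ IH1].
  + rewrite (_ : (fun w x => _) = fun w x =>
        2^-1 * (pairing (u + v) w x + pairing (u - v) w x)).
      by apply: trig_scale; apply: trig_add; exact: trig_pairing.
    by apply/funext => w; apply/funext => x; exact: pairingM.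
  + rewrite (_ : (fun w x => _) = fun w x =>
        pairing u w x * l1 w x + pairing u w x * l2 w x).
      exact: trig_add.
    by apply/funext => w; apply/funext => x; rewrite mulrDr.
  + rewrite (_ : (fun w x => _) = fun w x => c * (pairing u w x * l1 w x)).
      exact: trig_scale.
    by apply/funext => w; apply/funext => x; rewrite mulrCA.
- rewrite (_ : (fun w x => _) = fun w x => k1 w x * l w x + k2 w x * l w x).
    exact: trig_add.
  by apply/funext => w; apply/funext => x; rewrite mulrDl.
- rewrite (_ : (fun w x => _) = fun w x => c * (k1 w x * l w x)).
    exact: trig_scale.
  by apply/funext => w; apply/funext => x; rewrite mulrA.
Qed.

Lemma trig_one : trig_kernel (fun _ _ => 1).
Proof.
rewrite (_ : (fun _ _ => 1) = pairing 0); first exact: trig_pairing.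
by apply/funext => w; apply/funext => x; rewrite pairing0.
Qed.

Lemma trig_prod I (r : seq I) (k : I -> T -> T -> R) :
  (forall i, trig_kernel (k i)) -> trig_kernel (fun w x => \prod_(i <- r) k i w x).
Proof.
move=> tk; elim: r => [|i r IH].
  rewrite (_ : (fun w x => _) = (fun _ _ => 1)); first exact: trig_one.
  by apply/funext => w; apply/funext => x; rewrite big_nil.
rewrite (_ : (fun w x => _) = (fun w x => k i w x * \prod_(j <- r) k j w x)).
  exact: trig_mul.
by apply/funext => w; apply/funext => x; rewrite big_cons.
Qed.

Lemma trig_exp k N : trig_kernel k -> trig_kernel (fun w x => k w x ^+ N).
Proof.
move=> tk; elim: N => [|N IH]; first exact: trig_one.
under eq_fun do under eq_fun do rewrite exprS.
exact: trig_mul.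
Qed.

Lemma continuous_trig k : trig_kernel k -> jointly_continuous k.
Proof.
elim=> [v|k1 k2 _ IH1 _ IH2|c k1 _ IH1].
- rewrite (_ : pairing v = fun w x => complex.Re (chi v w) * complex.Re (chi v x) +
      complex.Im (chi v w) * complex.Im (chi v x)); last first.
    by apply/funext => w; apply/funext => x; exact: pairing_split.
  have [cr ci] := (@continuous_Re_chi v, @continuous_Im_chi v).
  exact (jointly_continuousD
    (jointly_continuousM (jointly_continuousl cr) (jointly_continuousr cr))
    (jointly_continuousM (jointly_continuousl ci) (jointly_continuousr ci))).
- exact (jointly_continuousD IH1 IH2).
- exact (jointly_continuousM (@jointly_continuous_cst R _ c) IH1).
Qed.

(** In angular notation, the product of the [cos ^+ 2 ((x_j - w_j) / 2)]. *)
Definition raised_cosine w x : R :=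
  \prod_(j < n) (2^-1 * (1 + pairing (delta_mx ord0 j) w x)).

Lemma trig_raised_cosine : trig_kernel raised_cosine.
Proof.
apply: trig_prod => j; apply: trig_scale; apply: trig_add; last exact: trig_pairing.
exact: trig_one.
Qed.

Lemma raised_cosine_mul a w x :
  raised_cosine (torus_mul a w) (torus_mul a x) = raised_cosine w x.
Proof. by apply: eq_bigr => j _; rewrite pairing_mul. Qed.

Lemma raised_cosine_factor j w x : 0 <= 2^-1 * (1 + pairing (delta_mx ord0 j) w x) <= 1.
Proof. by have := norm_pairing (delta_mx ord0 j) w x; rewrite ler_norml; lra. Qed.

Lemma raised_cosine_ge0 w x : 0 <= raised_cosine w x.
Proof. by apply: prodr_ge0 => j _; case/andP: (raised_cosine_factor j w x). Qed.

Lemma raised_cosine_le1 w x : raised_cosine w x <= 1.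
Proof. by apply: prodr_ile1 => j _; exact: raised_cosine_factor. Qed.

Lemma raised_cosine_diag x : raised_cosine x x = 1.
Proof.
by apply: big1 => j _; rewrite pairing_diag mulVf.
Qed.

Lemma raised_cosine_eq1 w x : raised_cosine w x = 1 -> w = x.
Proof.
move=> b1; apply: torus_ext => j; rewrite -!chi_delta; apply: pairing_eq1.
apply/eqP; rewrite eq_le; have := norm_pairing (delta_mx ord0 j) w x.
rewrite ler_norml => /andP[_ ->] /=.
suff : 1 <= 2^-1 * (1 + pairing (delta_mx ord0 j) w x) by lra.
apply: (@le_trans _ _ (raised_cosine w x)); first by rewrite b1.
rewrite /raised_cosine (bigD1 j)//= ler_piMr//.
  by case/andP: (raised_cosine_factor j w x).
by apply: prodr_ile1 => i _; exact: raised_cosine_factor.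
Qed.

End kernels.

(** * Means with respect to Haar measure *)

Section means.
Context {R : realType} {n : nat} (tau : probability (borel_torus R n) R).
Local Notation T := (torus R n).
Implicit Types (u f : T -> R).

Definition mean u : R := (\int[tau]_z u z)%R.

Lemma eq_mean u f : u =1 f -> mean u = mean f.
Proof. by move=> /funext ->. Qed.

Lemma continuous_torus_bounded u : continuous u ->
  exists2 M, 0 <= M & forall z, `|u z| <= M.
Proof.
move=> cu.
have cn : {within [set: T], continuous (fun z => `|u z|)}.
  by apply: continuous_subspaceT; exact (continuous_normf cu).
have T0 : [set: T] !=set0 by exists (torus_one n).
have [c _ cM] := compact_EVT_max T0 (@torus_compact R n) cn.
by exists `|u c| => // z; apply: cM; rewrite inE.
Qed.

Lemma continuous_torus_measurable u : continuous u ->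
  measurable_fun [set: borel_torus R n] u.
Proof.
move=> /continuousP cu; apply: (measurability _ (RGenOpens.measurableE R)).
move=> _ [_ [a [b ->] <-]]; rewrite setTI; apply: sub_sigma_algebra.
by apply: cu; exact: interval_open.
Qed.

Lemma continuous_torus_integrable u : continuous u ->
  tau.-integrable [set: borel_torus R n] (EFin \o u).
Proof.
move=> cu; apply: measurable_bounded_integrable => //.
- by rewrite (le_lt_trans (probability_le1 tau measurableT))// ltry.
- exact: continuous_torus_measurable.
- have [M M0 uM] := continuous_torus_bounded cu.
  exists M; split; first exact: num_real.
  by move=> N MN z _ /=; rewrite (le_trans (uM z))// ltW.
Qed.

Lemma mean_cst c : mean (fun=> c) = c.
Proof.
rewrite /mean Rintegral_cst// -[RHS]mulr1; congr (_ * _).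
exact: (congr1 fine (probability_setT tau)).
Qed.

Lemma meanD u f : continuous u -> continuous f ->
  mean (fun z => u z + f z) = mean u + mean f.
Proof. by move=> cu cf; apply: RintegralD => //; exact: continuous_torus_integrable. Qed.

Lemma meanB u f : continuous u -> continuous f ->
  mean (fun z => u z - f z) = mean u - mean f.
Proof. by move=> cu cf; apply: RintegralB => //; exact: continuous_torus_integrable. Qed.

Lemma meanZ c u : continuous u -> mean (fun z => c * u z) = c * mean u.
Proof. by move=> cu; apply: RintegralZl => //; exact: continuous_torus_integrable. Qed.

Lemma le_mean u f : continuous u -> continuous f ->
  (forall z, u z <= f z) -> mean u <= mean f.
Proof.
by move=> cu cf uf; apply: le_Rintegral => //; exact: continuous_torus_integrable.
Qed.

Lemma le_norm_mean u f : continuous u -> continuous f ->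
  (forall z, `|u z| <= f z) -> `|mean u| <= mean f.
Proof.
move=> cu cf uf; rewrite ler_norml; apply/andP; split.
  rewrite -mulN1r -meanZ//; apply: le_mean => //.
    exact: (continuous_funM (@cst_continuous _ _ _) cf).
  by move=> z; have := uf z; rewrite ler_norml mulN1r => /andP[].
by apply: le_mean => // z; rewrite (le_trans (ler_norm _)).
Qed.

Lemma mean_sum (I : Type) (r : seq I) (g : I -> T -> R) :
  (forall i, continuous (g i)) ->
  mean (fun z => \sum_(i <- r) g i z) = \sum_(i <- r) mean (g i).
Proof.
move=> cg; elim: r => [|i r IH].
  by under [in LHS]eq_fun do rewrite big_nil; rewrite mean_cst big_nil.
under [in LHS]eq_fun do rewrite big_cons.
by rewrite meanD ?IH ?big_cons//; exact: continuous_sum.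
Qed.

Hypothesis haar : is_haar tau.

Lemma torus_mulVK (a : T) : exists b, cancel (torus_mul a) (torus_mul b) /\
  cancel (torus_mul b) (torus_mul a).
Proof.
have a1 i : `|(tcoord a i)^*| = 1 by rewrite normcJ normr_tcoord.
exists (mk_torus a1); split=> z; apply: torus_ext => i.
  by rewrite !tcoord_mk mulrA [_^* * _]mulrC -sqr_normc normr_tcoord expr1n mul1r.
by rewrite !tcoord_mk mulrA -sqr_normc normr_tcoord expr1n mul1r.
Qed.

(** The defining property of [is_haar] says that images of measurable sets keep
    their measure; the image under [torus_mul a] is the preimage under the
    inverse translation, which gives invariance of the pushforward. *)
Lemma mean_translate a u : continuous u -> mean (u \o torus_mul a) = mean u.
Proof.
move=> cu; rewrite /mean /Rintegral; congr fine.
pose phi : borel_torus R n -> borel_torus R n := torus_mul a.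
have mphi : measurable_fun setT phi.
  apply: (@measurability _ _ (borel_torus R n) (borel_torus R n) setT phi (@open T) erefl).
  move=> _ [A oA <-].
  rewrite setTI; apply: sub_sigma_algebra.
  by have /continuousP := @continuous_torus_mul R n a; exact.
have cua : continuous (u \o torus_mul a).
  by move=> z; apply: continuous_comp; [exact: continuous_torus_mul|exact: cu].
have := @integral_pushforward _ _ _ _ R phi mphi tau setT (EFin \o u).
rewrite preimage_setT => <- //.
- apply: eq_measure_integral => A mA _; rewrite /pushforward.
  have [b [ab ba]] := torus_mulVK a.
  apply: etrans (haar b mA); congr (tau _).
  apply/seteqP; split => [z Az|_ [z Az <-]].
    by exists (phi z) => //; exact: ab.
  by rewrite /= /phi ba.
- by apply/measurable_EFinP; exact: continuous_torus_measurable.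
- exact: (continuous_torus_integrable cua).
Qed.

(** Translating by a point where the character is -1 changes its sign. *)
Lemma mean_chi (v : 'rV[int]_n) : v != 0 ->
  mean (fun z => complex.Re (chi v z)) = 0 /\ mean (fun z => complex.Im (chi v z)) = 0.
Proof.
move=> /(@chi_eqN1 R) [a va].
have e u : continuous u -> (forall z, u (torus_mul a z) = -1 * u z) -> mean u = 0.
  move=> cu ua; have := mean_translate a cu.
  rewrite (_ : u \o _ = fun z => -1 * u z); last by apply/funext => z; exact: ua.
  by rewrite meanZ//; lra.
split; apply: e.
- exact: continuous_Re_chi.
- by move=> z; rewrite chi_mul va; case: (chi v z) => x y /=; ring.
- exact: continuous_Im_chi.
- by move=> z; rewrite chi_mul va; case: (chi v z) => x y /=; ring.
Qed.

End means.

(** * Uniform approximation by trigonometric polynomials *)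

Section approximation.
Context {R : realType} {n : nat} (tau : probability (borel_torus R n) R).
Hypothesis haar : is_haar tau.
Local Notation T := (torus R n).
Implicit Types (f g : T -> R) (w x : T).

Lemma raised_cosineC w x : raised_cosine w x = raised_cosine x w.
Proof. by apply: eq_bigr => j _; rewrite pairingC. Qed.

Lemma continuous_raised_cosineX N w : continuous (fun x => raised_cosine w x ^+ N).
Proof.
exact: (separately_continuous (continuous_trig (trig_exp N trig_raised_cosine))).2.
Qed.

Definition raised_cosine_mass N := mean tau (fun x => raised_cosine (torus_one n) x ^+ N).

Lemma mean_raised_cosine N w :
  mean tau (fun x => raised_cosine w x ^+ N) = raised_cosine_mass N.
Proof.
rewrite -(mean_translate haar w (@continuous_raised_cosineX N w)) /raised_cosine_mass.
have w1 : torus_mul w (torus_one n) = w.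
  by apply: torus_ext => i; rewrite !tcoord_mk mulr1.
apply: eq_mean => x /=.
by rewrite -{1}w1 raised_cosine_mul.
Qed.

(** The open sets [raised_cosine w > q] cover the torus, so finitely many of
    them do.  At each point the sum of the corresponding [raised_cosine w ^+ N] is then
    at least [q ^+ N], and by translation invariance each summand has the same
    mean; [d] is one more than the number of sets. *)
Lemma raised_cosine_mass_ge q : 0 < q < 1 ->
  exists2 d : R, 0 < d & forall N, q ^+ N <= d * raised_cosine_mass N.
Proof.
move=> /andP[q0 q1].
have cb w : continuous (raised_cosine w).
  exact: (separately_continuous (continuous_trig trig_raised_cosine)).2.
have := @torus_compact R n; rewrite compact_cover.
move=> /(_ T setT (fun w => [set x | q < raised_cosine w x])) [].
- move=> w _; by have /continuousP /(_ _ (@open_gt R q)) := cb w.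
- by move=> x _; exists x => //=; rewrite raised_cosine_diag.
move=> D _ Dcov; pose s : seq T := finmap.enum_fset D.
exists (1 + \sum_(w <- s) 1) => [|N].
  by rewrite ltr_pwDl// sumr_ge0.
have I0 : 0 <= raised_cosine_mass N.
  by rewrite -(mean_cst tau 0); apply: le_mean => [||z]; [exact: cst_continuous|
    exact: continuous_raised_cosineX|exact/exprn_ge0/raised_cosine_ge0].
apply: (@le_trans _ _ (mean tau (fun x => \sum_(w <- s) raised_cosine w x ^+ N))).
  rewrite -(mean_cst tau (q ^+ N)); apply: le_mean.
  - exact: cst_continuous.
  - by apply: continuous_sum => w; exact: continuous_raised_cosineX.
  - move=> x; have [w /= wD qw] := Dcov x I.
    rewrite (big_rem w wD)//= ler_wpDr//.
      by apply: sumr_ge0 => y _; exact/exprn_ge0/raised_cosine_ge0.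
    by apply: lerXn2r; rewrite ?nnegrE ?raised_cosine_ge0// ltW.
rewrite mean_sum; last by move=> w; exact: continuous_raised_cosineX.
rewrite mulrDl mul1r ler_wpDl// mulr_suml ler_sum// => w _.
by rewrite mul1r mean_raised_cosine.
Qed.

(** Where [f w] is within [e] of [f x] the integrand is at most [e * g w]; elsewhere
    the weight [g] is at most [d] and the oscillation of [f] at most [2 * M]. *)
Lemma smoothing_error f g x (M e d : R) : continuous f -> continuous g ->
  (forall w, `|f w| <= M) -> (forall w, 0 <= g w) -> 0 < mean tau g ->
  0 <= e -> 0 <= d -> (forall w, e <= `|f w - f x| -> g w <= d) ->
  `|mean tau (fun w => f w * ((mean tau g)^-1 * g w)) - f x| <=
    e + 2 * M * d / mean tau g.
Proof.
move=> cf cg fM g0 + e0 d0 fg; set I := mean tau g => I0.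
have M0 : 0 <= M by rewrite (le_trans _ (fM x)).
have cfg : continuous (fun w => f w * g w) by exact (continuous_funM cf cg).
have cxg : continuous (fun w => f x * g w).
  exact (continuous_funM (@cst_continuous _ _ _) cg).
have ceg : continuous (fun w => e * g w).
  exact (continuous_funM (@cst_continuous _ _ _) cg).
have cd : continuous (fun _ : T => 2 * M * d) by exact: cst_continuous.
have -> : mean tau (fun w => f w * (I^-1 * g w)) = I^-1 * mean tau (fun w => f w * g w).
  by rewrite -(meanZ tau I^-1 cfg); apply: eq_mean => w; exact: mulrCA.
have -> : I^-1 * mean tau (fun w => f w * g w) - f x =
    I^-1 * mean tau (fun w => f w * g w - f x * g w).
  by rewrite (meanB tau cfg cxg) (meanZ tau (f x) cg) mulrBr -/I mulrCA
    mulVf ?gt_eqF// mulr1.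
rewrite normrM gtr0_norm ?invr_gt0// mulrC ler_pdivrMr// mulrDl divfK ?gt_eqF//.
have <- : mean tau (fun w => e * g w + 2 * M * d) = e * I + 2 * M * d.
  by rewrite (meanD tau ceg cd) (meanZ tau e cg) mean_cst.
apply: (le_norm_mean tau (continuous_funB cfg cxg) (continuous_funD ceg cd)) => w.
rewrite -mulrBl normrM [X in _ * X]ger0_norm//.
have [h|h] := leP e `|f w - f x|.
  rewrite ler_wpDl//; first exact: mulr_ge0.
  apply: ler_pM => //; last exact: fg.
  by rewrite (le_trans (ler_normB _ _))//; have := fM w; have := fM x; lra.
rewrite ler_wpDr//; first by rewrite !mulr_ge0.
by rewrite ler_wpM2r// ltW.
Qed.

(** Uniform approximation by trigonometric polynomials: smooth [f] with a
    normalized high power of [raised_cosine]. *)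
Lemma kernel_approx f (eps : R) : continuous f -> 0 < eps ->
  exists2 k, trig_kernel k & forall x, `|mean tau (fun w => f w * k w x) - f x| <= eps.
Proof.
move=> cf e0.
have [q /andP[q0 q1] fq] := peak_gap (@torus_compact R n)
  (continuous_trig trig_raised_cosine) (@raised_cosine_le1 R n)
  (@raised_cosine_ge0 R n) (@raised_cosine_eq1 R n) cf (divr_gt0 e0 (ltr0n _ 2)).
have [M M0 fM] := continuous_torus_bounded cf.
(* Any value strictly between [q] and 1 makes [(q / q') ^+ N] tend to 0. *)
pose q' := (1 + q) / 2.
have q'0 : 0 < q' by rewrite /q'; lra.
have [d d0 dq] := @raised_cosine_mass_ge q' ltac:(rewrite /q'; lra).
have r0 : 0 <= q / q' by apply: divr_ge0 => //; exact: ltW.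
have r1 : `|q / q'| < 1.
  by rewrite ger0_norm// ltr_pdivrMr// mul1r /q'; lra.
have [N hN] : exists N, 2 * M * d * (q / q') ^+ N <= eps / 2.
  have c0 : 0 < 2 * M * d + 1 by rewrite ltr_wpDl// !mulr_ge0// ltW.
  have := cvg_expr r1 => /cvgr0_norm_le /(_ _ (divr_gt0 (divr_gt0 e0 (ltr0n _ 2)) c0)).
  case=> N _ /(_ N (leqnn N)) /= hN; exists N.
  move: hN; rewrite ger0_norm ?exprn_ge0//.
  rewrite ler_pdivlMr// => /(le_trans _); apply.
  by rewrite mulrC ler_wpM2l ?exprn_ge0 ?lerDl.
have [I [I0 mI dqI]] : exists I : R, [/\ 0 < I,
    forall x, mean tau (fun w => raised_cosine w x ^+ N) = I & q' ^+ N <= d * I].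
  exists (raised_cosine_mass N); split; last exact: dq.
    by have := lt_le_trans (exprn_gt0 N q'0) (dq N); rewrite pmulr_rgt0.
  by move=> x; rewrite -(mean_raised_cosine N x); apply: eq_mean => w;
    rewrite raised_cosineC.
exists (fun w x => I^-1 * raised_cosine w x ^+ N).
  by apply: trig_scale; apply: trig_exp; exact: trig_raised_cosine.
move=> x.
have cbx : continuous (fun w => raised_cosine w x ^+ N).
  exact: (separately_continuous (continuous_trig (trig_exp N trig_raised_cosine))).1.
have g0 w : 0 <= raised_cosine w x ^+ N by exact/exprn_ge0/raised_cosine_ge0.
have gq w : eps / 2 <= `|f w - f x| -> raised_cosine w x ^+ N <= q ^+ N.
  by move=> /fq; apply: lerXn2r; rewrite nnegrE; [exact: raised_cosine_ge0|].
have mI0 : 0 < mean tau (fun w => raised_cosine w x ^+ N) by rewrite mI.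
have h0 : 0 <= eps / 2 by rewrite divr_ge0// ltW.
have := smoothing_error cf cbx fM g0 mI0 h0 (exprn_ge0 N q0) gq.
rewrite mI => /le_trans; apply.
suff : 2 * M * q ^+ N / I <= eps / 2 by lra.
rewrite ler_pdivrMr//.
have -> : 2 * M * q ^+ N = 2 * M * (q / q') ^+ N * q' ^+ N.
  by rewrite -[RHS]mulrA -exprMn divfK// gt_eqF.
apply: (@le_trans _ _ (2 * M * (q / q') ^+ N * (d * I))).
  by rewrite ler_wpM2l// ?mulr_ge0// exprn_ge0.
have -> : 2 * M * (q / q') ^+ N * (d * I) = 2 * M * d * (q / q') ^+ N * I by ring.
by rewrite ler_wpM2r// ltW.
Qed.

End approximation.

(** * Equidistribution *)

(** If [v *m A] were 0, then [sup_norm v] would bound the height of [A]. *)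
Lemma boyd_height_mulmx_neq0 (R : realType) n m (A : 'M[int]_(n, m)) (v : 'rV[int]_n) :
  v != 0 -> ((sup_norm v).+1%:R%:E <= boyd_height A R)%E -> v *m A != 0.
Proof.
move=> v0 + ; apply: contraTneq => vA0; rewrite /boyd_height.
have Nv : relation_norms A (sup_norm v) by exists v.
case: pselect => [ex|[]]; last by exists (sup_norm v); exact/asboolP.
case: ex_minnP => k _ kmin; rewrite lee_fin ler_nat -leqNgt.
by apply: kmin; exact/asboolP.
Qed.

Section equidistribution.
Context {R : realType} {n : nat}.
Context (tau1 : probability (borel_torus R 1) R) (tau : probability (borel_torus R n) R).
Hypotheses (haar1 : is_haar tau1) (haar : is_haar tau).
Local Notation T := (torus R n).
Implicit Types (f u : T -> R).

(** The limit formula of Boyd and Lawton in the strong form satisfied by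
    trigonometric polynomials: equality for all large heights. *)
Definition eventually_exact u := continuous u /\
  exists M : nat, forall r : 'cV[int]_n, (M%:R%:E <= boyd_height r R)%E ->
    mean tau1 (fun z => u (qmap r z)) = mean tau u.

Lemma continuous_qmap_comp m (A : 'M[int]_(n, m)) (U : topologicalType) (f : T -> U) :
  continuous f -> continuous (fun z => f (qmap A z)).
Proof.
by move=> cf z; apply: (continuous_comp (@continuous_qmap R n m A z)); exact: cf.
Qed.

Lemma eventually_exact_cst (c : R) : eventually_exact (fun=> c).
Proof.
split; first exact: cst_continuous.
by exists 0%N => r _; rewrite (mean_cst tau1) (mean_cst tau).
Qed.

Lemma eventually_exactZ c u : eventually_exact u -> eventually_exact (fun x => c * u x).
Proof.
move=> [cu [M uM]]; split; first exact (continuous_funM (@cst_continuous _ _ c) cu).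
exists M => r rM; rewrite (meanZ tau1 c (continuous_qmap_comp (A := r) cu)).
by rewrite (meanZ tau c cu) uM.
Qed.

Lemma eventually_exactD u f : eventually_exact u -> eventually_exact f ->
  eventually_exact (fun x => u x + f x).
Proof.
move=> [cu [M uM]] [cf [N fN]]; split; first exact (continuous_funD cu cf).
exists (maxn M N) => r rMN.
have rM : (M%:R%:E <= boyd_height r R)%E.
  by apply: le_trans rMN; rewrite lee_fin ler_nat leq_maxl.
have rN : (N%:R%:E <= boyd_height r R)%E.
  by apply: le_trans rMN; rewrite lee_fin ler_nat leq_maxr.
rewrite (meanD tau1 (continuous_qmap_comp (A := r) cu)
  (continuous_qmap_comp (A := r) cf)).
by rewrite (meanD tau cu cf) uM// fN.
Qed.

(** For nonzero [v], both means vanish when the height of [r] exceeds the sup norm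
    of [v], since [chi v] pulls back to the nontrivial character [chi (v *m r)]. *)
Lemma eventually_exact_chi (v : 'rV[int]_n) :
  eventually_exact (fun x => complex.Re (chi v x)) /\
  eventually_exact (fun x => complex.Im (chi v x)).
Proof.
have [->|v0] := eqVneq v 0.
  split.
    rewrite (_ : (fun x => _) = fun=> 1); first exact: eventually_exact_cst.
    by apply/funext => x; rewrite chi0.
  rewrite (_ : (fun x => _) = fun=> 0); first exact: eventually_exact_cst.
  by apply/funext => x; rewrite chi0.
have [ReT ImT] := mean_chi haar v0.
split; (split; first by [exact: continuous_Re_chi|exact: continuous_Im_chi]);
  exists (sup_norm v).+1 => r /(boyd_height_mulmx_neq0 v0) vr0;
  have [Re1 Im1] := mean_chi haar1 vr0.
  rewrite ReT -[RHS]Re1; apply: eq_mean => z.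
  by rewrite chi_qmap.
rewrite ImT -[RHS]Im1; apply: eq_mean => z.
by rewrite chi_qmap.
Qed.

(** The angle difference formulas separate the variables of the kernel, so that
    smoothing yields a finite combination of real and imaginary parts of
    characters. *)
Lemma eventually_exact_smoothing k f : trig_kernel k -> continuous f ->
  eventually_exact (fun x => mean tau (fun w => f w * k w x)).
Proof.
move=> tk cf; elim: tk => [v|k1 k2 t1 IH1 t2 IH2|c k1 t1 IH1].
- have [eR eI] := eventually_exact_chi v.
  have cR : continuous (fun w => f w * complex.Re (chi v w)).
    exact (continuous_funM cf (@continuous_Re_chi _ _ v)).
  have cI : continuous (fun w => f w * complex.Im (chi v w)).
    exact (continuous_funM cf (@continuous_Im_chi _ _ v)).
  have -> : (fun x => mean tau (fun w => f w * pairing v w x)) = (fun x =>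
      mean tau (fun w => f w * complex.Re (chi v w)) * complex.Re (chi v x) +
      mean tau (fun w => f w * complex.Im (chi v w)) * complex.Im (chi v x)).
    apply/funext => x; rewrite ![mean _ _ * _]mulrC -(meanZ tau _ cR) -(meanZ tau _ cI).
    have cR' := continuous_funM (@cst_continuous _ _ (complex.Re (chi v x))) cR.
    have cI' := continuous_funM (@cst_continuous _ _ (complex.Im (chi v x))) cI.
    rewrite -(meanD tau cR' cI'); apply: eq_mean => w.
    have distr (a b c d g : R) : a * (b * c + d * g) = c * (a * b) + g * (a * d) by ring.
    by rewrite pairing_split; exact: distr.
  exact (eventually_exactD (eventually_exactZ _ eR) (eventually_exactZ _ eI)).
- have -> : (fun x => mean tau (fun w => f w * (k1 w x + k2 w x))) =
      (fun x => mean tau (fun w => f w * k1 w x) + mean tau (fun w => f w * k2 w x)).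
    apply/funext => x.
    have c1 := continuous_funM cf ((separately_continuous (continuous_trig t1)).1 x).
    have c2 := continuous_funM cf ((separately_continuous (continuous_trig t2)).1 x).
    by rewrite -(meanD tau c1 c2); apply: eq_mean => w; exact: mulrDr.
  exact (eventually_exactD IH1 IH2).
- have -> : (fun x => mean tau (fun w => f w * (c * k1 w x))) =
      (fun x => c * mean tau (fun w => f w * k1 w x)).
    apply/funext => x.
    have c1 := continuous_funM cf ((separately_continuous (continuous_trig t1)).1 x).
    by rewrite -(meanZ tau c c1); apply: eq_mean => w; exact: mulrCA.
  exact (eventually_exactZ c IH1).
Qed.

Lemma mean_dist (m : nat) (nu : probability (borel_torus R m) R) (u g : torus R m -> R)
    (e : R) : continuous u -> continuous g -> (forall z, `|u z - g z| <= e) ->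
  `|mean nu u - mean nu g| <= e.
Proof.
move=> cu cg ug; rewrite -(meanB nu cu cg) -(mean_cst nu e).
exact: (le_norm_mean nu (continuous_funB cu cg) (@cst_continuous _ _ e) ug).
Qed.

(** Replace [f] by a trigonometric polynomial within [e / 2], at the same cost
    for both means. *)
Lemma torus_equidistribution f (e : R) : continuous f -> 0 < e ->
  exists M : nat, forall r : 'cV[int]_n, (M%:R%:E <= boyd_height r R)%E ->
    `|mean tau1 (fun z => f (qmap r z)) - mean tau f| <= e.
Proof.
move=> cf e0; have e2 : 0 < e / 2 by rewrite divr_gt0.
have [k tk kf] := kernel_approx haar cf e2.
have [cp [M pM]] := eventually_exact_smoothing tk cf.
move: cp pM kf; set p := (fun x => mean tau _) => cp pM kf.
exists M => r /pM pr.
have h1 := mean_dist tau cp cf kf.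
have h2 := mean_dist tau1 (continuous_qmap_comp (A := r) cp)
  (continuous_qmap_comp (A := r) cf)
  (fun z => kf (qmap r z)).
move: h1 h2; rewrite pr !ler_norml => /andP[a b] /andP[c d]; apply/andP; split; lra.
Qed.

End equidistribution.

(** * Complex-valued functions *)

Section complex_valued.
Context {R : realType} {n : nat} (tau : probability (borel_torus R n) R).
Local Notation C := (Cplx R).

Lemma normC_le_sum (x y : R) : `|(x +i* y : C)| <= (`|x| + `|y|)%:C.
Proof.
rewrite normc_def lecR /= -(ler_pXn2r (n := 2))// ?nnegrE ?sqrtr_ge0 ?addr_ge0//.
rewrite sqr_sqrtr ?addr_ge0 ?sqr_ge0// sqrrD !real_normK ?num_real//.
by rewrite lerD2r lerDl mulrn_wge0// mulr_ge0.
Qed.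

Lemma continuous_ReIm (f : torus R n -> C) : continuous f ->
  continuous (fun z => complex.Re (f z)) /\ continuous (fun z => complex.Im (f z)).
Proof.
move=> cf; split=> z.
  apply: (@continuous_comp _ _ _ f (fun z : C => complex.Re z)); first exact: cf.
  exact: continuous_Re.
apply: (@continuous_comp _ _ _ f (fun z : C => complex.Im z)); first exact: cf.
exact: continuous_Im.
Qed.

Lemma continuous_represents (f : torus R n -> C) : continuous f ->
  represents tau f (Some \o f).
Proof.
move=> /continuous_ReIm[cR cI]; split; last exact: aeW.
by split; exact: continuous_torus_integrable.
Qed.

End complex_valued.

Theorem proposition4p2 (R : realType)
    (tau : forall n : nat, probability (borel_torus R n) R)
    (haar_tau : forall n : nat, is_haar (tau n)) :
  Boyd_Lawton tau (@continuous_collection R).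
Proof.
split.
- by move=> n _ _ [f cf <-]; exists f; exact: continuous_represents.
- move=> n _ _ [f cf <-]; exists (cintegral (tau n) f).
    by exists f => //; exact: continuous_represents.
  move=> eps eps0; have [cR cI] := continuous_ReIm cf.
  (* Any share below one half for the real and imaginary parts makes the sum
     of their errors strictly less than [eps]. *)
  have e3 : 0 < eps / 3 by rewrite divr_gt0.
  have [M MP] := torus_equidistribution (haar_tau 1%N) (haar_tau n) cR e3.
  have [N NP] := torus_equidistribution (haar_tau 1%N) (haar_tau n) cI e3.
  exists (maxn M N) => r rMN.
  have /MP hR : (M%:R%:E <= boyd_height r R)%E.
    by apply: le_trans rMN; rewrite lee_fin ler_nat leq_maxl.
  have /NP hI : (N%:R%:E <= boyd_height r R)%E.
    by apply: le_trans rMN; rewrite lee_fin ler_nat leq_maxr.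
  exists (cintegral (tau 1%N) (f \o qmap r)).
    exists (f \o qmap r) => //; apply: continuous_represents.
    exact: continuous_qmap_comp.
  apply: le_lt_trans (normC_le_sum _ _) _; rewrite ltcR.
  by apply: le_lt_trans (lerD hR hI) _; lra.
- move=> n _ _ [f cf <-]; exists 0%N => m _ A _.
  by exists (f \o qmap A) => //; exact: continuous_qmap_comp.
Qed.
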